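(* Let $(X,d,\mu)$ be a metric measure space with $\mu(X)=\infty$, and suppose that there exist $N>0$ and constants $C_1,C_2>0$ such that $$C_1r^N\le\mu B(x,r)\le C_2r^N\qquad\text{for all }x\in X,\ r>0.$$ Then the maximal operator $M$ is bounded in the Morrey space $\mathcal{L}^{p,\lambda}(X)$ for $1<p<\infty$, $0\le\lambda<N$.
   Context: $(X,d,\mu)$ is a homogeneous metric measure space with quasidistance $d$ and measure $\mu$, and $B(x,r)=\{y\in X:d(x,y)<r\}$. The Morrey space $\mathcal{L}^{p,\lambda}(X)$ has norm $$\|f\|_{p,\lambda}=\sup_{x\in X,\,r>0}\left\{\frac1{r^\lambda}\int_{B(x,r)}|f(y)|^p\,d\mu(y)\right\}^{1/p}.$$ The maximal operator is $Mf(x)=\sup_{r>0}\frac{1}{\mu B(x,r)}\int_{B(x,r)}|f(y)|\,d\mu(y)$. *)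

(* Defs.v *)
From HB Require Import structures.
From mathcomp Require Import all_boot all_order all_algebra.
From mathcomp Require Import all_classical all_reals all_analysis.
From mathcomp Require Import measurable_realfun.

Set Implicit Arguments.
Unset Strict Implicit.
Unset Printing Implicit Defensive.

Import Order.TTheory GRing.Theory Num.Theory.

Local Open Scope classical_set_scope.
Local Open Scope ring_scope.

Record is_quasidistance (R : realType) (X : Type) (d : X -> X -> R) : Prop :=
  IsQuasidistance {
    qd_ge0 : forall x y, 0 <= d x y ;
    qd_eq0 : forall x y, d x y = 0 <-> x = y ;
    qd_sym : forall x y, d x y = d y x ;
    qd_triangle : exists2 k : R, 1 <= k &
      forall x y z, d x z <= k * (d x y + d y z)
  }.

Definition qball (R : realType) (X : Type) (d : X -> X -> R) (x : X) (r : R) :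
  set X := [set y | d x y < r].

(* The open sets of the topology induced by a quasidistance. *)
Definition qopen (R : realType) (X : Type) (d : X -> X -> R) (U : set X) :
  Prop := forall x, U x -> exists2 r : R, 0 < r & qball d x r `<=` U.

(* Space of homogeneous type in the sense of Coifman and Weiss.  The balls of a
   quasidistance need not be open for the topology it induces; as usual this is
   part of the definition (for a distance it is automatic).  The sigma-algebra
   of X is only required to contain the Borel sets, so that completed Borel
   measures are covered. *)
Record is_homogeneous_space (R : realType) (disp : measure_display)
    (X : measurableType disp) (d : X -> X -> R)
    (mu : {measure set X -> \bar R}) : Prop := IsHomogeneousSpace {
  hs_quasidistance : is_quasidistance d ;
  hs_qball_open : forall x r, 0 < r -> qopen d (qball d x r) ;
  hs_borel : forall U : set X, qopen d U -> measurable U ;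
  hs_qball_gt0 : forall x r, 0 < r -> (0 < mu (qball d x r))%E ;
  hs_qball_fin : forall x r, 0 < r -> (mu (qball d x r) < +oo)%E ;
  hs_doubling : exists C : R, forall x r, 0 < r ->
    (mu (qball d x (2 * r)) <= C%:E * mu (qball d x r))%E
}.

Local Open Scope ereal_scope.

Definition morrey_norm (R : realType) (disp : measure_display)
    (X : measurableType disp) (d : X -> X -> R)
    (mu : {measure set X -> \bar R}) (p lambda : R) (f : X -> \bar R) :
    \bar R :=
  ereal_sup [set z | exists (x : X) (r : R), (0 < r)%R /\
    z = (((r `^ lambda)^-1)%:E *
          \int[mu]_(y in qball d x r) (`|f y| `^ p)) `^ p^-1].

(* The elements are measurable functions rather than classes modulo equality
   almost everywhere.  Values are extended reals because the maximal function
   may be infinite on a null set; finiteness of the norm makes a member finite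
   almost everywhere. *)
Definition morrey_space (R : realType) (disp : measure_display)
    (X : measurableType disp) (d : X -> X -> R)
    (mu : {measure set X -> \bar R}) (p lambda : R) : set (X -> \bar R) :=
  [set f : X -> \bar R | measurable_fun [set: X] f /\
    morrey_norm d mu p lambda f < +oo].

Definition maximal_function (R : realType) (disp : measure_display)
    (X : measurableType disp) (d : X -> X -> R)
    (mu : {measure set X -> \bar R}) (f : X -> \bar R) (x : X) : \bar R :=
  ereal_sup [set (mu (qball d x r))^-1 * \int[mu]_(y in qball d x r) `|f y|
            | r in [set r : R | (0 < r)%R]].

Definition bounded_in_morrey (R : realType) (disp : measure_display)
    (X : measurableType disp) (d : X -> X -> R)
    (mu : {measure set X -> \bar R}) (p lambda : R)
    (T : (X -> \bar R) -> (X -> \bar R)) : Prop :=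
  exists2 C : R, (0 <= C)%R & forall f, morrey_space d mu p lambda f ->
    morrey_space d mu p lambda (T f) /\
    morrey_norm d mu p lambda (T f) <= C%:E * morrey_norm d mu p lambda f.

(* Main.v *)
Require Import Defs.
From HB Require Import structures.
From mathcomp Require Import all_boot all_order all_algebra finmap.
From mathcomp Require Import all_classical all_reals all_analysis.
From mathcomp Require Import measurable_realfun.
From mathcomp Require Import ring lra.

Set Implicit Arguments.
Unset Strict Implicit.
Unset Printing Implicit Defensive.

Import Order.TTheory GRing.Theory Num.Theory.

Local Open Scope classical_set_scope.
Local Open Scope ring_scope.

(** The proof splits the maximal function over a ball [B = B(x, r)] according to
the radius of the averages involved, with [A] a bound for the Morrey norm of [f]
and [e = A * r `^ ((lambda - N) / p)], the size that the Morrey condition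
suggests for [f] at scale [r].

Averages over radii [t >= r] are at most a constant times [e]: pointwise
[|f| <= e + e ^ (1 - p) |f| ^ p], and the Morrey condition makes the average of
the second term at most [e ^ (1 - p) A ^ p t ^ (lambda - N) / C1 <= e / C1],
because [lambda < N] ([morrey_average_le]).  Hence where [M f] exceeds
[s = (1 + 1 / C1) e] on [B], only radii smaller than [r] count, and only the
values of [f] in [B(x, 2 k r)] matter, [k] being the constant of the
quasi-triangle inequality.

On that set the usual real-variable method applies.  A selection of disjoint
balls gives the weak type inequality ([vitali_selection], [vitali_weak_type]);
discarding the values of [f] below half the level and summing over the levels
[2 ^ n s] gives the strong type inequality ([local_strong_type]):
[\int_B (M f) ^ p <= s ^ p mu B + K \int_(B(x, 2 k r)) |f| ^ p].
Since [s ^ p mu B] is of order [A ^ p r ^ (lambda - N) r ^ N], both terms are of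
order [A ^ p r ^ lambda].  Starting the levels at [s] rather than at [0] is
what merges the contribution of large radii with the level-set summation, so
that the global boundedness of [M] in L^p is never invoked.

Measurability of [M f] comes from the balls being open: [x |-> \int_B(x, r) |f|]
and [x |-> mu B(x, r)] are lower semicontinuous, and since a ball is the
increasing union of the smaller concentric ones, rational radii suffice in the
supremum. *)

(** * Selection of disjoint sets *)

(** Vitali selection with radii [t x]: a greedy choice, made by Zorn's lemma.  Among
disjoint subfamilies [D] such that every set meeting some member of [D] meets
one of at least half its radius, take a maximal one.  Were some set disjoint
from all members, adding one whose radius is more than half the supremum of the
radii of such sets would contradict maximality. *)
Lemma vitali_selection (R : realType) (X : Type) (B : X -> set X)
    (t : X -> R) (E : set X) (M : R) :
  (forall x, E x -> 0 < t x <= M) -> (forall x, E x -> B x !=set0) ->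
  exists D : set X, [/\ D `<=` E, trivIset D B &
    forall x, E x -> exists2 y, D y & B x `&` B y !=set0 /\ t x <= 2 * t y].
Proof.
move=> tE B0.
pose meets x y := B x `&` B y !=set0.
pose P : set (set X) := fun D => [/\ D `<=` E, trivIset D B &
  forall x, E x -> (exists2 y, D y & meets x y) ->
    exists2 y, D y & meets x y /\ t x <= 2 * t y].
have [|D [[DE tD cD] maxD]] := @Zorn_bigcup _ P.
  move=> F FP totF; split.
  - by move=> x [D FD Dx]; have [DE _ _] := FP _ FD; exact: DE.
  - move=> i j [D FD Di] [D' FD' D'j].
    have [DD'|D'D] := totF _ _ FD FD'.
    + by have [_ + _] := FP _ FD'; apply => //; exact: DD'.
    + by have [_ + _] := FP _ FD; apply => //; exact: D'D.
  - move=> x Ex [y [D FD Dy] xy].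
    have [_ _ /(_ x Ex)] := FP _ FD; case; first by exists y.
    by move=> z Dz xz; exists z => //; exists D.
exists D; split => // x0 Ex0.
have [|nx0] := pselect (exists2 y, D y & meets x0 y); first exact: cD.
(* S collects the radii of the sets that meet no member of D. *)
exfalso.
pose S := [set s | exists2 x, E x /\ ~ (exists2 y, D y & meets x y) & s = t x].
have S0 : S !=set0 by exists (t x0); exists x0.
have ubS : ubound S M by move=> _ [x [Ex _] ->]; have /andP[] := tE x Ex.
have hS : has_sup S by split => //; exists M.
have supS0 : 0 < sup S.
  apply: (@lt_le_trans _ _ (t x0)); first by have /andP[] := tE x0 Ex0.
  by apply: ub_le_sup; [exists M|exists x0].
have [_ [x1 [Ex1 nx1] ->] x1S] : exists2 s, S s & sup S / 2 < s.
  by apply: sup_gt => //; lra.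
apply: (maxD (D `|` [set x1])).
  split; first exact: subsetUl.
  move=> /(_ x1 (or_intror erefl)) Dx1; apply: nx1; exists x1 => //.
  by rewrite /meets setIid; exact: B0.
split.
- by move=> x [/DE//|->].
- move=> i j [Di|->] [Dj|->] //; first exact: tD.
  + by move=> ij; exfalso; apply: nx1; exists i => //; rewrite /meets setIC.
  + by move=> ij; exfalso; apply: nx1; exists j.
- move=> x Ex [y Dy xy].
  have [/cD[//|z Dz xz]|nx] := pselect (exists2 z, D z & meets x z).
    by exists z => //; left.
  case: Dy => [Dy|y1]; first by exfalso; apply: nx; exists y.
  exists x1; [by right|split; first by rewrite -y1].
  have : t x <= sup S by apply: ub_le_sup; [exists M|exists x].
  by lra.
Qed.

(** At most [mu U * n] of the sets have measure above [1 / n]. *)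
Lemma countable_disjoint_measure_gt0 (R : realType) (disp : measure_display)
    (X : measurableType disp) (mu : {measure set X -> \bar R})
    (I : choiceType) (D : set I) (F : I -> set X) (U : set X) :
  measurable U -> (mu U < +oo)%E -> trivIset D F ->
  (forall i, D i -> [/\ measurable (F i), F i `<=` U & (0 < mu (F i))%E]) ->
  countable D.
Proof.
move=> mU Uoo tD FD.
have muF i : D i -> mu (F i) \is a fin_num.
  move=> /FD[mF FU F0]; rewrite ge0_fin_numE//.
  by apply: le_lt_trans Uoo; apply: le_measure; rewrite ?inE.
have -> : D = \bigcup_n [set i | D i /\ n.+1%:R^-1 < fine (mu (F i))].
  apply/seteqP; split=> [i Di|i [n _ []]//].
  have : 0 < fine (mu (F i)).
    by have [_ _ F0] := FD _ Di; rewrite fine_gt0// F0 -ge0_fin_numE ?muF.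
  by move=> /ltr_add_invr[n]; rewrite add0r => nF; exists n.
apply: bigcup_countable => // n _; apply: finite_set_countable.
apply: contrapT => infD.
have [u0 ufin] : 0 <= fine (mu U) /\ mu U \is a fin_num.
  split; first exact: fine_ge0.
  by rewrite ge0_fin_numE.
pose m := (Num.truncn (fine (mu U) * n.+1%:R)).+1.
have [B BD mB] := infinite_set_fset m infD.
have : (\sum_(i <- B) mu (F i) <= mu U)%E.
  have : (mu (\bigcup_(i in [set` B]) F i) <= mu U)%E.
    apply: le_measure; rewrite ?inE//.
      apply: fin_bigcup_measurable => // i Bi.
      by have [/FD[]] := BD _ Bi.
    by move=> x [i Bi Fx]; have [/FD[_ FU _] _] := BD _ Bi; exact: FU.
  rewrite measure_fin_bigcup//; last 2 first.
  - by move=> i j /BD[Di _] /BD[Dj _]; exact: tD.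
  - by move=> i /BD[/FD[]].
  by rewrite fsbig_finite//= set_fsetK.
apply/negP; rewrite -ltNge.
apply: (@lt_le_trans _ _ (\sum_(i <- B) (n.+1%:R^-1)%:E)%E); last first.
  rewrite !big_seq; apply: lee_sum => i iB.
  have [Di nF] := BD i iB.
  by rewrite -[leRHS]fineK ?muF// lee_fin ltW.
rewrite sumEFin -[ltLHS]fineK// lte_fin big_const_seq count_predT iter_addr_0.
rewrite -[ltRHS]mulr_natr [ltRHS]mulrC ltr_pdivlMr//.
apply: lt_le_trans (truncnS_gt _) _.
by rewrite ler_nat.
Qed.

(** * Dyadic sums *)

(** A geometric sum is at most a constant times its last term; here the last term
counted is the one just below [v]. *)
Lemma dyadic_sum_le (R : realType) (a s v : R) n : 0 < a -> 0 < s -> 0 <= v ->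
  \sum_(0 <= i < n) (if 2 ^+ i * s < v then (2 ^+ i * s) `^ a else 0) <=
  2 `^ a / (2 `^ a - 1) * v `^ a.
Proof.
move=> a0 s0 v0; set q := 2 `^ a.
have q1 : 1 < q.
  rewrite -[ltLHS](_ : 1 `^ a = 1); last by rewrite powR1.
  by apply: gt0_ltr_powR => //; rewrite ?nnegrE//; lra.
pose S n := \sum_(0 <= i < n) (if 2 ^+ i * s < v then (2 ^+ i * s) `^ a else 0).
have powS m : (2 ^+ m.+1 * s) `^ a = q * (2 ^+ m * s) `^ a.
  by rewrite exprS -mulrA powRM// mulr_ge0// ?exprn_ge0// ltW.
suff [] : S n <= (2 ^+ n * s) `^ a / (q - 1) /\ S n <= q / (q - 1) * v `^ a.
  by [].
have qv : 0 <= q / (q - 1) * v `^ a.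
  by rewrite mulr_ge0 ?powR_ge0// divr_ge0//; lra.
elim: n => [|n [IH1 IH2]].
  rewrite /S big_geq//; split => //.
  by rewrite divr_ge0 ?powR_ge0//; lra.
have -> : S n.+1 = S n + (if 2 ^+ n * s < v then (2 ^+ n * s) `^ a else 0).
  by rewrite /S big_nat_recr.
have q0 : 0 < q - 1 by lra.
have pn0 : 0 <= (2 ^+ n * s) `^ a by exact: powR_ge0.
rewrite powS; case: ifPn => [nv|_]; last first.
  rewrite !addr0; split=> //; apply: le_trans IH1 _.
  by rewrite ler_pM2r ?invr_gt0// ler_peMl// ltW.
have E1 : S n + (2 ^+ n * s) `^ a <= q * (2 ^+ n * s) `^ a / (q - 1).
  rewrite (_ : q * _ / _ = (2 ^+ n * s) `^ a / (q - 1) + (2 ^+ n * s) `^ a).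
    by rewrite lerD2r.
  by field; rewrite gt_eqF.
split=> //; apply: le_trans E1 _.
rewrite mulrAC ler_pM2l; last by rewrite divr_gt0//; lra.
apply: ge0_ler_powR; rewrite ?nnegrE//; first exact: ltW.
- by rewrite mulr_ge0 ?exprn_ge0// ltW.
- exact: ltW.
Qed.

Local Open Scope ereal_scope.

(** The layer-cake formula discretised at the levels [2 ^ n * s]: above [s], the
term of the last level below [v] already dominates [v `^ p]. *)
Lemma poweR_le_dyadic_sum (R : realType) (p s : R) (v : \bar R) :
  (0 < p)%R -> (0 < s)%R -> 0 <= v ->
  v `^ p <= (s `^ p)%:E +
    \sum_(n <oo)
      (if ((2 ^+ n * s)%:E < v)%E then (2 ^+ n.+1 * s) `^ p else 0%R)%:E.
Proof.
move=> p0 s0 v0.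
pose u n : \bar R :=
  (if ((2 ^+ n * s)%:E < v)%E then (2 ^+ n.+1 * s) `^ p else 0%R)%:E.
change (v `^ p <= (s `^ p)%:E + \sum_(n <oo) u n).
have u0 n : 0 <= u n by rewrite /u lee_fin; case: ifP; rewrite ?powR_ge0.
have partial m : \sum_(0 <= n < m) u n <= \sum_(n <oo) u n.
  by apply: nneseries_lim_ge => n _ _; exact: u0.
have powmono x y : (0 <= x)%R -> (x <= y)%R -> (x `^ p <= y `^ p)%R.
  move=> x0 xy; apply: ge0_ler_powR; rewrite ?nnegrE//; first exact: ltW.
  exact: le_trans xy.
have two_ge n : (1 <= 2 ^+ n :> R)%R by rewrite exprn_ege1// ler1n.
case: v v0 @u u0 partial => [v||]// v0 u u0 partial.
  have [n vn] : exists n, (v <= 2 ^+ n * s)%R.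
    exists (Num.truncn (v / s)).+1; rewrite -ler_pdivrMr//.
    apply: (le_trans (ltW (truncnS_gt _))).
    by rewrite -natrX ler_nat ltnW// ltn_expl.
  apply: le_trans (leeD2l _ (partial n)).
  elim: n vn => [|n IH] vn.
    rewrite big_geq// adde0 lee_fin; apply: powmono => //.
    by rewrite expr0 mul1r in vn.
  rewrite big_nat_recr//= addeA.
  have [vn'|nv] := leP v (2 ^+ n * s)%R.
    by apply: le_trans (IH vn') _; rewrite leeDl.
  rewrite {2}/u lte_fin nv.
  apply: (@le_trans _ _ ((2 ^+ n.+1 * s) `^ p)%:E).
    by rewrite lee_fin; apply: powmono.
  rewrite leeDr// adde_ge0 ?lee_fin ?powR_ge0//.
  by rewrite sume_ge0.
suff -> : \sum_(n <oo) u n = +oo by rewrite addey ?leey.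
apply/eqyP => A A0.
have sp : (0 < s `^ p)%R by rewrite powR_gt0.
pose m := (Num.truncn (A / s `^ p)).+1.
apply: le_trans (partial m).
apply: (@le_trans _ _ (\sum_(0 <= n < m) (s `^ p)%:E)); last first.
  apply: lee_sum => n _; rewrite /u ltry lee_fin.
  by apply: powmono; [exact: ltW|rewrite ler_peMl// ltW].
rewrite sumEFin lee_fin sumr_const_nat subn0 -[leRHS]mulr_natl.
by rewrite -ler_pdivrMr// ltW// truncnS_gt.
Qed.
Local Close Scope ereal_scope.

(** Replaces Hoelder's inequality: [v] above [e] is at most
[v * (v / e) `^ (p - 1)]. *)
Lemma le_threshold_poweR (R : realType) (e p : R) (v : \bar R) :
  0 < e -> 1 < p -> (0 <= v)%E ->
  (v <= e%:E + (e / e `^ p)%:E * v `^ p)%E.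
Proof.
move=> e0 p1; have p0 : 0 < p by lra.
have c0 : 0 < e / e `^ p by rewrite divr_gt0// powR_gt0.
case: v => [v||]// v0; last first.
  by rewrite poweRyr ?gt_eqF// gt0_muley// addey// leey.
rewrite poweR_EFin -EFinM -EFinD lee_fin.
have [ve|ev] := leP v e.
  by apply: le_trans ve _; rewrite lerDl mulr_ge0 ?powR_ge0// ltW.
suff : v <= e / e `^ p * v `^ p by lra.
rewrite mulrAC ler_pdivlMr ?powR_gt0// -(mulr_powRB1 v0 p0).
rewrite -(mulr_powRB1 (ltW e0) p0) mulrA [leRHS]mulrA (mulrC e v).
apply: ler_wpM2l; first by rewrite mulr_ge0// ltW.
by apply: ge0_ler_powR; rewrite ?nnegrE ?subr_ge0 //; exact: ltW.
Qed.

(** * Measurability of the maximal function *)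

Lemma integral_bigcup_le (R : realType) (disp : measure_display)
    (X : measurableType disp) (mu : {measure set X -> \bar R})
    (G : nat -> set X) (h : X -> \bar R) (c : \bar R) :
  nondecreasing_seq G -> (forall n, measurable (G n)) ->
  measurable_fun setT h -> (forall x, (0 <= h x)%E) ->
  (forall n, (\int[mu]_(x in G n) h x <= c)%E) ->
  (\int[mu]_(x in \bigcup_n G n) h x <= c)%E.
Proof.
move=> ndG mG mh h0 Gc.
have mhG n : measurable_fun (G n) h by exact: measurable_funTS.
have cvgG := ge0_nondecreasing_set_cvg_integral ndG mG mhG (fun n x _ => h0 x).
rewrite -(cvg_lim _ (cvgG mu))//; apply: lime_le; last exact: nearW.
by apply/cvg_ex; eexists; exact: cvgG.
Qed.

Section homogeneous.
Context (R : realType) (disp : measure_display) (X : measurableType disp).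
Variables (d : X -> X -> R) (mu : {measure set X -> \bar R}).
Hypothesis hX : is_homogeneous_space d mu.

Let qd := hs_quasidistance hX.

Lemma qball_le0 x r : r <= 0 -> qball d x r = set0.
Proof.
move=> r0; apply/seteqP; split => // y /=; rewrite /qball/= => xy.
by have := qd_ge0 qd x y; lra.
Qed.

Lemma qball_center x r : 0 < r -> qball d x r x.
Proof. by move=> r0; rewrite /qball/= (_ : d x x = 0)//; apply/(qd_eq0 qd). Qed.

Lemma subset_qball x r s : r <= s -> qball d x r `<=` qball d x s.
Proof. by move=> rs y /= /lt_le_trans; exact. Qed.

Lemma measurable_qball x r : measurable (qball d x r).
Proof.
have [r0|r0] := ltP 0 r; last by rewrite qball_le0.
by apply: (hs_borel hX); exact: (hs_qball_open hX).
Qed.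

Lemma fin_num_qball x r : 0 < r -> mu (qball d x r) \is a fin_num.
Proof. by move=> r0; rewrite ge0_fin_numE// (hs_qball_fin hX). Qed.

Lemma le_mu_qball x r s : r <= s -> (mu (qball d x r) <= mu (qball d x s))%E.
Proof.
move=> rs; apply: le_measure; rewrite ?inE; last exact: subset_qball.
  exact: measurable_qball.
exact: measurable_qball.
Qed.

(** Lower semicontinuity in the centre: for fixed [z] the ball [B(z, r)] is open, so
by symmetry [z] in [B(x, r)] forces [z] in [B(u, r)] for [u] near [x]; along a
sequence tending to [x], monotone convergence over the intersections of the
tails of the balls then plays the part of Fatou's lemma. *)
Lemma qopen_qball_integral_gt (h : X -> \bar R) (c : \bar R) (r : R) :
  measurable_fun setT h -> (forall x, (0 <= h x)%E) ->
  qopen d [set x | (c < \int[mu]_(y in qball d x r) h y)%E].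
Proof.
move=> mh h0 x /=; have [r0|r0] := leP r 0.
  move=> cx; exists 1 => // y _ /=; move: cx.
  by rewrite !qball_le0.
move=> cx; apply: contrapT => nx.
have {}nx n : exists y, d x y < n.+1%:R^-1 /\
    (\int[mu]_(z in qball d y r) h z <= c)%E.
  apply: contrapT => ny; apply: nx; exists n.+1%:R^-1.
    by rewrite invr_gt0.
  move=> y xy /=; rewrite ltNge; apply/negP => yc; apply: ny; by exists y.
have [u /all_and2[xu uc]] := choice nx.
pose G n := \bigcap_(m in [set m | (n <= m)%N]) qball d (u m) r.
have mG n : measurable (G n).
  apply: bigcap_measurable => [|m _]; first by exists n => /=.
  exact: measurable_qball.
have ndG : nondecreasing_seq G.
  move=> m n mn; rewrite subsetEset => z Gz k /= nk; apply: Gz => /=.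
  exact: leq_trans nk.
have xG : qball d x r `<=` \bigcup_n G n.
  move=> z xz.
  have zx : qball d z r x by rewrite /qball/= (qd_sym qd).
  have [e e0 ez] := hs_qball_open hX r0 zx.
  have [n _ ne] : exists2 n, true & n.+1%:R^-1 < e.
    by have [n] := ltr_add_invr e0; rewrite add0r => ne; exists n.
  exists n => // m /= nm; rewrite /qball/= (qd_sym qd); apply: ez.
  rewrite /qball/=; apply: lt_trans (xu m) _; apply: le_lt_trans ne.
  by rewrite lef_pV2 ?posrE// ler_nat ltnS.
have : (\int[mu]_(z in \bigcup_n G n) h z <= c)%E.
  apply: integral_bigcup_le => // n; apply: le_trans (uc n).
  apply: ge0_subset_integral => //; first exact: measurable_qball.
    exact: measurable_funTS.
  by move=> z; apply => /=.
apply/negP; rewrite -ltNge; apply: lt_le_trans cx _.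
apply: ge0_subset_integral => //; first exact: measurable_qball.
  exact: bigcupT_measurable.
exact: measurable_funTS.
Qed.

Lemma measurable_qball_integral (h : X -> \bar R) (r : R) :
  measurable_fun setT h -> (forall x, (0 <= h x)%E) ->
  measurable_fun setT (fun x => \int[mu]_(y in qball d x r) h y)%E.
Proof.
move=> mh h0 mT; apply: (measurability _ (ErealGenOInfty.measurableE R)) => //.
move=> _ [_ [c ->] <-]; rewrite setTI; apply: (hs_borel hX).
have := @qopen_qball_integral_gt h c%:E r mh h0.
congr qopen; apply/seteqP; split => x /=; by rewrite in_itv/= andbT.
Qed.

Lemma measurable_mu_qball (r : R) :
  measurable_fun setT (fun x => mu (qball d x r)).
Proof.
have := @measurable_qball_integral (cst 1%E) r (measurable_cst _)
  (fun=> lee01).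
apply: eq_measurable_fun => x _.
by rewrite integral_cst ?mul1e//; exact: measurable_qball.
Qed.

Lemma average_gtE (c : R) x r (I : \bar R) : 0 < r ->
  (c%:E < (mu (qball d x r))^-1 * I)%E = (c%:E * mu (qball d x r) < I)%E.
Proof.
move=> r0; have m0 := hs_qball_gt0 hX x r0; have mfin := fin_num_qball x r0.
move: m0; rewrite -(fineK mfin) lte_fin => m0.
by rewrite inver gt_eqF// lte_pdivlMl// muleC.
Qed.

(** Clearing the denominator leaves two lower semicontinuous functions of the
centre, which can be compared measurably. *)
Lemma maximal_function_gtP (f : X -> \bar R) (c : R) x :
  (c%:E < maximal_function d mu f x)%E <-> exists2 r, 0 < r &
    (c%:E * mu (qball d x r) < \int[mu]_(y in qball d x r) `|f y|)%E.
Proof.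
split.
  move/ereal_sup_gt => [_ [r /= r0 <-]]; rewrite average_gtE// => cr.
  by exists r.
move=> [r r0]; rewrite -average_gtE// => /lt_le_trans; apply.
by apply: ereal_sup_ubound; exists r.
Qed.

Lemma maximal_function_ge0 (f : X -> \bar R) x :
  (0 <= maximal_function d mu f x)%E.
Proof.
apply: le_trans (ereal_sup_ubound _); last by exists 1 => //=; exact: ltr01.
by rewrite mule_ge0// ?inve_ge0// integral_ge0.
Qed.

(** The supremum may be restricted to rational radii: an inequality between
averages at radius [r] persists for slightly smaller radii, where the integral
is almost the same and the measure of the ball is not larger. *)
Lemma measurable_maximal_function (f : X -> \bar R) :
  measurable_fun setT f -> measurable_fun setT (maximal_function d mu f).
Proof.
move=> mf mT; apply: (measurability _ (ErealGenOInfty.measurableE R)) => //.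
have mabs : measurable_fun setT (fun x => `|f x|%E).
  exact: measurableT_comp.
move=> _ [_ [c ->] <-]; rewrite setTI.
have [c0|c0] := ltP c 0.
  rewrite (_ : _ @^-1` _ = setT)//; apply/seteqP; split => // x _ /=.
  rewrite in_itv/= andbT; apply: lt_le_trans (maximal_function_ge0 f x).
  by rewrite lte_fin.
pose S (q : rat) := if 0 < ratr q :> R then
  [set x | (c%:E * mu (qball d x (ratr q)) <
            \int[mu]_(y in qball d x (ratr q)) `|f y|)%E] else set0.
rewrite (_ : _ @^-1` _ = \bigcup_q S q); last first.
  apply/seteqP; split => x /=; rewrite in_itv/= andbT; last first.
    move=> [q _]; rewrite /S; case: ifPn => // q0 /= qx.
    by apply/maximal_function_gtP; exists (ratr q).
  move/maximal_function_gtP => [r r0 cr].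
  pose G n := qball d x (r - n.+1%:R^-1).
  have ballG : qball d x r = \bigcup_n G n.
    apply/seteqP; split => [y /= xy|y [n _]].
      have [n] := ltr_add_invr xy.
      by rewrite -ltrBrDr => ny; exists n.
    by apply: subset_qball; rewrite gerBl.
  have [n cn] : exists n,
      (c%:E * mu (qball d x r) < \int[mu]_(y in G n) `|f y|)%E.
    apply: contrapT => /forallNP nG.
    have : (\int[mu]_(y in \bigcup_n G n) `|f y| <= c%:E * mu (qball d x r))%E.
      apply: integral_bigcup_le => //.
      - move=> m n mn; rewrite subsetEset; apply: subset_qball.
        by rewrite lerB// lef_pV2 ?posrE// ler_nat ltnS.
      - by move=> n; exact: measurable_qball.
      - by move=> n; rewrite leNgt; exact/negP.
    by rewrite -ballG leNgt cr.
  have [q] : exists q : rat, Num.max 0 (r - n.+1%:R^-1) < ratr q < r.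
    have := @rat_in_itvoo R (Num.max 0 (r - n.+1%:R^-1)) r.
    case; first by rewrite gt_max r0/= gtrBl invr_gt0.
    by move=> q; rewrite in_itv/= => ?; exists q.
  rewrite gt_max => /andP[/andP[q0 nq] qr].
  exists q => //; rewrite /S q0/=.
  apply: le_lt_trans (lt_le_trans cn _).
    by apply: lee_wpmul2l; [rewrite lee_fin|exact: le_mu_qball (ltW _)].
  apply: ge0_subset_integral => //; try exact: measurable_qball.
    exact: measurable_funTS.
  exact: subset_qball (ltW _).
apply: bigcupT_measurable_rat => q; rewrite /S; case: ifPn => // q0.
rewrite -[X in measurable X]setTI; apply: measurable_lte => //.
  by apply: measurable_funeM; exact: measurable_mu_qball.
exact: measurable_qball_integral.
Qed.


(** * The weak type inequality *)

Variables (N C1 C2 k : R).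
Hypotheses (hC1 : 0 < C1) (hC2 : 0 < C2) (hk : 1 <= k).
Hypothesis hmu : forall (x : X) (r : R), 0 < r ->
  ((C1 * r `^ N)%:E <= mu (qball d x r))%E /\
  (mu (qball d x r) <= (C2 * r `^ N)%:E)%E.
Hypothesis triangle : forall x y z, d x z <= k * (d x y + d y z).

(** Enlarging a ball by the factor [3 * k], as the covering argument requires,
multiplies its measure by at most this constant. *)
Definition vitali_const := C2 / C1 * (3 * k) `^ N.

Lemma vitali_const_gt0 : 0 < vitali_const.
Proof. by rewrite mulr_gt0 ?divr_gt0// powR_gt0; have := hk; lra. Qed.

Lemma mu_dilated_qball x r : 0 < r ->
  (mu (qball d x (3 * k * r)) <= vitali_const%:E * mu (qball d x r))%E.
Proof.
move=> r0; have k0 : 0 < 3 * k by have := hk; lra.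
have [_ +] := hmu x (mulr_gt0 k0 r0); move=> /le_trans; apply.
have [+ _] := hmu x r0.
move/(lee_wpmul2l (_ : (0 <= vitali_const%:E)%E)).
rewrite lee_fin => /(_ (ltW vitali_const_gt0)); apply: le_trans.
rewrite -EFinM lee_fin (powRM _ (ltW k0) (ltW r0)) le_eqVlt; apply/orP; left.
by apply/eqP; rewrite /vitali_const; field; rewrite gt_eqF.
Qed.

Lemma subset_dilated_qball x y t r :
  qball d x r `&` qball d y t !=set0 -> r <= 2 * t ->
  qball d y (3 * k * t) x.
Proof.
move=> [z [xz yz]] rt; rewrite /qball/= in xz yz *.
apply: le_lt_trans (triangle y z x) _.
have k0 : 0 < k by have := hk; lra.
by rewrite (qd_sym qd z x) (mulrC 3) -mulrA ltr_pM2l//; lra.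
Qed.

(** Each point of [E] is the centre of a ball in [U] on which [g] has average at
least [s].  The enlargements of the selected disjoint balls cover [E], and the
measure of each is controlled by the integral of [g] over the disjoint
originals. *)
Lemma vitali_weak_type (g : X -> \bar R) (E U : set X) (t : X -> R) (M s : R) :
  measurable_fun setT g -> (forall y, (0 <= g y)%E) ->
  measurable E -> measurable U -> (mu U < +oo)%E -> 0 < s ->
  (forall y, E y -> [/\ 0 < t y <= M, qball d y (t y) `<=` U &
    (s%:E * mu (qball d y (t y)) <= \int[mu]_(z in qball d y (t y)) g z)%E]) ->
  (mu E <= (vitali_const / s)%:E * \int[mu]_(z in U) g z)%E.
Proof.
move=> mg g0 mE mU Uoo s0 Et.
pose B y := qball d y (t y).
have t0 y : E y -> 0 < t y by move=> /Et[/andP[]].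
have [|y Ey|D [DE tD cD]] := @vitali_selection R X B t E M.
- by move=> y /Et[].
- by exists y; apply: qball_center; exact: t0.
have /countable_injP[e einj] : countable D.
  apply: (countable_disjoint_measure_gt0 mU Uoo tD) => y /DE Ey.
  have [_ BU _] := Et y Ey.
  by split=> //; [exact: measurable_qball|exact: hs_qball_gt0 (t0 _ Ey)].
(* Enumerating the centres along the injection [e] leaves gaps: [at_ n] is the
   singleton of the centre numbered n, or empty. *)
pose at_ n := D `&` [set y | e y = n].
have atP n : at_ n = set0 \/ exists2 y, E y & at_ n = [set y].
  have [[y [Dy ey]]|n0] := pselect (exists y, at_ n y); last first.
    by left; apply/seteqP; split => // y ny; apply: n0; exists y.
  right; exists y; first exact: DE.
  apply/seteqP; split => [z [Dz ez]|_ ->//].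
  by apply: einj; rewrite ?inE// ey.
pose B1 n := \bigcup_(y in at_ n) B y.
pose B3 n := \bigcup_(y in at_ n) qball d y (3 * k * t y).
have mB1 n : measurable (B1 n).
  rewrite /B1; case: (atP n) => [->|[y _ ->]]; first by rewrite bigcup_set0.
  by rewrite bigcup_set1; exact: measurable_qball.
have mB3 n : measurable (B3 n).
  rewrite /B3; case: (atP n) => [->|[y _ ->]]; first by rewrite bigcup_set0.
  by rewrite bigcup_set1; exact: measurable_qball.
have B3_le n :
    (mu (B3 n) <= (vitali_const / s)%:E * \int[mu]_(z in B1 n) g z)%E.
  rewrite /B3 /B1; case: (atP n) => [->|[y Ey ->]].
    by rewrite !bigcup_set0 measure0 integral_set0 mule0.
  rewrite !bigcup_set1; apply: le_trans (mu_dilated_qball y (t0 y Ey)) _.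
  rewrite (EFinM vitali_const) -muleA; apply: lee_wpmul2l.
    by rewrite lee_fin ltW// vitali_const_gt0.
  by rewrite lee_pdivlMl//; have [] := Et y Ey.
have tB1 : trivIset setT B1.
  move=> i j _ _ [z [[y [Dy <-] yz] [y' [Dy' <-] y'z]]].
  by congr e; apply: tD => //; exists z.
have EB3 : E `<=` \bigcup_n B3 n.
  move=> y Ey; have [y' Dy' [yy' tt']] := cD y Ey.
  exists (e y') => //; exists y' => //.
  exact: subset_dilated_qball yy' tt'.
have : (mu E <= \sum_(n <oo) mu (B3 n))%E.
  exact: measure_sigma_subadditive mB3 mE EB3.
move=> /le_trans; apply.
have sumB3 : (\sum_(n <oo) mu (B3 n) <=
    \sum_(n <oo) (vitali_const / s)%:E * \int[mu]_(z in B1 n) g z)%E.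
  by apply: lee_nneseries => n *; [exact: measure_ge0|exact: B3_le].
apply: le_trans sumB3 _.
have c0 : 0 <= vitali_const / s by rewrite divr_ge0 ?ltW// vitali_const_gt0.
rewrite nneseriesZl; last by move=> n _; exact: integral_ge0.
apply: lee_wpmul2l; first by rewrite lee_fin.
rewrite -ge0_integral_bigcup//; last exact: measurable_funTS.
apply: ge0_subset_integral => //; first exact: bigcupT_measurable.
  exact: measurable_funTS.
by move=> z [n _ [y [/DE/Et[_ BU _] _] /BU]].
Qed.

Definition cut (f : X -> \bar R) (c : R) (y : X) : \bar R :=
  if (c%:E < `|f y|)%E then `|f y|%E else 0%E.

Lemma cut_ge0 f c y : (0 <= cut f c y)%E.
Proof. by rewrite /cut; case: ifP. Qed.

Lemma measurable_cut f c :
  measurable_fun setT f -> measurable_fun setT (cut f c).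
Proof.
move=> mf; have mabs : measurable_fun setT (fun x => `|f x|%E).
  exact: measurableT_comp.
by apply: measurable_fun_ifT => //; apply: measurable_fun_lte.
Qed.

(** The values of [|f|] not above [s / 2] contribute at most [s / 2] to the average.
This gain is what makes the sum over the levels converge in
[local_strong_type]. *)
Lemma average_cut_ge (f : X -> \bar R) (s : R) x r : measurable_fun setT f ->
  0 < s -> 0 < r ->
  (s%:E * mu (qball d x r) < \int[mu]_(y in qball d x r) `|f y|)%E ->
  ((s / 2)%:E * mu (qball d x r) <=
   \int[mu]_(y in qball d x r) cut f (s / 2) y)%E.
Proof.
move=> mf s0 r0 sx.
have mB := measurable_qball x r.
have mabs : measurable_fun setT (fun x => `|f x|%E).
  exact: measurableT_comp.
have : (\int[mu]_(y in qball d x r) `|f y| <=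
    \int[mu]_(y in qball d x r) cut f (s / 2) y +
    (s / 2)%:E * mu (qball d x r))%E.
  rewrite -integral_cst// -ge0_integralD//; last 3 first.
  - by move=> y _; exact: cut_ge0.
  - by apply: measurable_funTS; exact: measurable_cut.
  - by move=> y _; rewrite lee_fin; lra.
  apply: ge0_le_integral => //.
  - exact: measurable_funTS.
  - apply: measurable_funTS; apply: emeasurable_funD => //.
    exact: measurable_cut.
  - move=> y _; rewrite /cut; case: ltP => [_|]; last by rewrite add0e.
    by rewrite leeDl// lee_fin; lra.
move: sx; have := fin_num_qball x r0.
have : (0 <= \int[mu]_(y in qball d x r) cut f (s / 2) y)%E.
  by apply: integral_ge0 => y _; exact: cut_ge0.
case: (\int[mu]_(y in qball d x r) cut _ _ _)%E => [I||]//; last first.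
  by move=> *; rewrite leey.
move=> _ /fineK <- /lt_le_trans /[apply].
by rewrite -!EFinM -EFinD lte_fin lee_fin; lra.
Qed.

(** When no ball of radius at least [r] has average above [s], the balls that put a
point of [B(x, r)] in the level set [s < M f] stay inside [B(x, 2 * k * r)]. *)
Lemma local_weak_type (f : X -> \bar R) (s : R) x r : measurable_fun setT f ->
  0 < s -> 0 < r ->
  (forall y t, r <= t ->
    (\int[mu]_(z in qball d y t) `|f z| <= s%:E * mu (qball d y t))%E) ->
  (mu (qball d x r `&` [set y | s%:E < maximal_function d mu f y]) <=
   (vitali_const / (s / 2))%:E *
     \int[mu]_(y in qball d x (2 * k * r)) cut f (s / 2) y)%E.
Proof.
move=> mf s0 r0 large.
set E := _ `&` _.
have Et y : exists t, E y -> 0 < t <= r /\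
    (s%:E * mu (qball d y t) < \int[mu]_(z in qball d y t) `|f z|)%E.
  have [Ey|nEy] := pselect (E y); last by exists 0.
  have [t t0 yt] := (maximal_function_gtP f s y).1 Ey.2.
  exists t => _; split=> //; rewrite t0/= leNgt; apply/negP => /ltW /(large y).
  by rewrite leNgt yt.
have [t {}Et] := choice Et.
have kr : 0 < 2 * k * r by rewrite !mulr_gt0//; have := hk; lra.
apply: (vitali_weak_type (t := t) (M := r)).
- exact: measurable_cut.
- by move=> y; exact: cut_ge0.
- apply: measurableI; first exact: measurable_qball.
  by rewrite -[X in measurable X]setTI; apply: emeasurable_fun_o_infty => //;
    exact: measurable_maximal_function.
- exact: measurable_qball.
- exact: (hs_qball_fin hX).
- by rewrite divr_gt0.
- move=> y Ey; have [/andP[ty0 tyr] yt] := Et y Ey; split.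
  + by rewrite ty0.
  + move=> z yz; case: Ey => xy _; rewrite /qball/= in xy yz *.
    apply: le_lt_trans (triangle x y z) _.
    have k0 : 0 < k by have := hk; lra.
    by rewrite (mulrC 2) -mulrA ltr_pM2l//; lra.
  + exact: average_cut_ge.
Qed.

(** * The strong type inequality on a ball *)

Variable p : R.
Hypothesis hp : 1 < p.

(** With [q = 2 `^ (p - 1)], the geometric constant [q / (q - 1)] of
[dyadic_sum_le], times the factor [q] lost by cutting [f] at half the level. *)
Definition dyadic_const := 2 `^ (p - 1) * (2 `^ (p - 1) / (2 `^ (p - 1) - 1)).

Lemma dyadic_const_gt0 : 0 < dyadic_const.
Proof.
have q0 : 0 < 2 `^ (p - 1) :> R by rewrite powR_gt0.
have q1 : 1 < 2 `^ (p - 1) :> R.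
  rewrite -[ltLHS](_ : 1 `^ (p - 1) = 1); last by rewrite powR1.
  by apply: gt0_ltr_powR; rewrite ?nnegrE//; have := hp; lra.
by rewrite mulr_gt0// divr_gt0// subr_gt0.
Qed.

(** Where [|f y| = v], the terms with [2 ^ n * s < 2 * v] survive, and they form a
geometric sum of order [v * v `^ (p - 1)]. *)
Lemma sum_cut_le (f : X -> \bar R) (s : R) y : 0 < s ->
  (\sum_(n <oo) ((2 ^+ n * s) `^ (p - 1))%:E * cut f (2 ^+ n * s / 2) y <=
   dyadic_const%:E * `|f y| `^ p)%E.
Proof.
move=> s0; have p1 : 0 < p - 1 by rewrite subr_gt0.
have p0 : 0 < p by have := hp; lra.
rewrite /cut; have := abse_ge0 (f y).
case: (`|f y|)%E => [v||]// v0; last first.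
  by rewrite poweRyr ?gt_eqF// gt0_muley ?leey// lte_fin dyadic_const_gt0.
have w0 n : 0 <= 2 ^+ n * (s / 2) by rewrite mulr_ge0 ?exprn_ge0//; lra.
apply: lime_le.
  apply: is_cvg_nneseries => n _ _.
  by rewrite mule_ge0// ?lee_fin ?powR_ge0//; case: ifP.
apply: nearW => m.
under eq_bigr => n _.
  rewrite (_ : (_ * _)%E = (v * 2 `^ (p - 1) *
      (if 2 ^+ n * (s / 2) < v then (2 ^+ n * (s / 2)) `^ (p - 1) else 0))%:E).
    over.
  rewrite lte_fin -mulrA; case: ifP => _; last by rewrite mule0 mulr0.
  rewrite -EFinM; congr EFin; rewrite -[in RHS]mulrA -powRM//.
  by rewrite mulrC; congr (_ * _ `^ _); field.
rewrite sumEFin poweR_EFin -EFinM lee_fin -mulr_sumr.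
rewrite -(mulr_powRB1 v0 p0) /dyadic_const.
rewrite [leRHS](_ : _ = v * 2 `^ (p - 1) *
  (2 `^ (p - 1) / (2 `^ (p - 1) - 1) * v `^ (p - 1))); last by ring.
apply: ler_wpM2l; first by rewrite mulr_ge0// powR_ge0.
by apply: dyadic_sum_le => //; rewrite divr_gt0.
Qed.

Definition strong_const := 2 `^ p * 2 * vitali_const * dyadic_const.

Lemma strong_const_gt0 : 0 < strong_const.
Proof.
apply: mulr_gt0 dyadic_const_gt0; apply: mulr_gt0 vitali_const_gt0.
by rewrite mulr_gt0// powR_gt0.
Qed.

(** Marcinkiewicz interpolation started at the level [s]: below [s] the bound
[M f <= s] is used, and at each level [2 ^ n * s] the weak type inequality for
the part of [f] above half that level. *)
Lemma local_strong_type (f : X -> \bar R) (s : R) x r : measurable_fun setT f ->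
  0 < s -> 0 < r ->
  (forall y t, r <= t ->
    (\int[mu]_(z in qball d y t) `|f z| <= s%:E * mu (qball d y t))%E) ->
  (\int[mu]_(y in qball d x r) (maximal_function d mu f y `^ p) <=
   (s `^ p)%:E * mu (qball d x r) +
   strong_const%:E * \int[mu]_(y in qball d x (2 * k * r)) (`|f y| `^ p))%E.
Proof.
move=> mf s0 r0 large.
have p0 : 0 < p by have := hp; lra.
have p1 : 0 < p - 1 by rewrite subr_gt0.
have mB := measurable_qball x r.
have mU := measurable_qball x (2 * k * r).
have mM := measurable_maximal_function mf.
have mMp : measurable_fun setT (fun y => maximal_function d mu f y `^ p)%E.
  exact: (measurableT_comp (measurable_poweR p)).
have mfp : measurable_fun setT (fun y => `|f y| `^ p)%E.
  by apply: (measurableT_comp (measurable_poweR p)); exact: measurableT_comp.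
pose w n : R := 2 ^+ n * s.
have w0 n : 0 < w n by rewrite mulr_gt0// exprn_gt0.
have sw n : s <= w n by rewrite ler_peMl ?(ltW s0)// exprn_ege1// ler1n.
pose A n := [set y | ((w n)%:E < maximal_function d mu f y)%E].
have mA n : measurable (A n).
  by rewrite -[X in measurable X]setTI; exact: emeasurable_fun_o_infty.
pose F n y : \bar R := (if ((w n)%:E < maximal_function d mu f y)%E
  then w n.+1 `^ p else 0)%:E.
have F0 n y : (0 <= F n y)%E by rewrite lee_fin; case: ifP; rewrite ?powR_ge0.
have FE n : F n = cst (w n.+1 `^ p)%:E \_ (A n).
  apply/funext => y; rewrite /F patchE /A; case: ifPn => h.
    by rewrite mem_set.
  by rewrite memNset//; exact/negP.
have mF n : measurable_fun setT (F n).
  rewrite FE; apply/(measurable_restrictT (cst _)) => //; exact: measurable_cst.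
have intF n : (\int[mu]_(y in qball d x r) F n y <=
    (2 `^ p * 2 * vitali_const)%:E *
    \int[mu]_(y in qball d x (2 * k * r))
      ((w n `^ (p - 1))%:E * cut f (w n / 2) y))%E.
  rewrite FE -integral_mkcondr integral_cst; last exact: measurableI.
  rewrite ge0_integralZl//; last 3 first.
  - by apply: measurable_funTS; exact: measurable_cut.
  - by move=> y _; exact: cut_ge0.
  - by rewrite lee_fin powR_ge0.
  rewrite muleA -EFinM.
  have := @local_weak_type f (w n) x r mf (w0 n) r0.
  have large' y t : r <= t -> (\int[mu]_(z in qball d y t) `|f z| <=
      (w n)%:E * mu (qball d y t))%E.
    move=> /large-/(_ y)/le_trans; apply.
    by apply: lee_wpmul2r; rewrite ?lee_fin.
  move=> /(_ large')/(lee_wpmul2l (_ : (0 <= (w n.+1 `^ p)%:E)%E)).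
  rewrite lee_fin => /(_ (powR_ge0 _ _)); rewrite setIC => /le_trans; apply.
  rewrite muleA -EFinM le_eqVlt; apply/orP; left; apply/eqP.
  congr (_%:E * _)%E.
  rewrite /w exprS -mulrA -/(w n) powRM ?(ltW (w0 n))//.
  rewrite -(mulr_powRB1 (ltW (w0 n)) p0).
  by field; rewrite gt_eqF.
apply: (@le_trans _ _ (\int[mu]_(y in qball d x r)
    ((s `^ p)%:E + \sum_(n <oo) F n y))%E).
  apply: ge0_le_integral => //.
  - by move=> y _; exact: poweR_ge0.
  - exact: measurable_funTS.
  - apply: emeasurable_funD; first exact: measurable_cst.
    by apply: measurable_funTS; apply: ge0_emeasurable_sum.
  - move=> y _; apply: poweR_le_dyadic_sum => //.
    exact: maximal_function_ge0.
rewrite ge0_integralD//; last 3 first.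
- by move=> y _; rewrite lee_fin powR_ge0.
- by move=> y _; exact: nneseries_ge0.
- by apply: measurable_funTS; apply: ge0_emeasurable_sum.
rewrite integral_cst//; apply: leeD2l.
rewrite integral_nneseries//; last by move=> n; exact: measurable_funTS.
apply: (@le_trans _ _ (\sum_(n <oo) (2 `^ p * 2 * vitali_const)%:E *
    \int[mu]_(y in qball d x (2 * k * r))
      ((w n `^ (p - 1))%:E * cut f (w n / 2) y))%E).
  by apply: lee_nneseries => n *; [exact: integral_ge0|exact: intF].
have c0 n y : (0 <= (w n `^ (p - 1))%:E * cut f (w n / 2) y)%E.
  by rewrite mule_ge0 ?lee_fin ?powR_ge0//; exact: cut_ge0.
rewrite nneseriesZl; last by move=> n _; exact: integral_ge0.
rewrite -integral_nneseries//; last first.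
  move=> n; apply: measurable_funTS; apply: measurable_funeM.
  exact: measurable_cut.
rewrite /strong_const (EFinM _ dyadic_const) -muleA; apply: lee_wpmul2l.
  by rewrite lee_fin mulr_ge0 ?(ltW vitali_const_gt0)// mulr_ge0// powR_ge0.
rewrite -ge0_integralZl//; last 3 first.
- exact: measurable_funTS.
- by move=> y _; exact: poweR_ge0.
- by rewrite lee_fin ltW// dyadic_const_gt0.
apply: ge0_le_integral => //.
- by move=> y _; exact: nneseries_ge0.
- apply: measurable_funTS; apply: ge0_emeasurable_sum => // n _.
  by apply: measurable_funeM; exact: measurable_cut.
- by apply: measurable_funTS; exact: measurable_funeM.
- by move=> y _; exact: sum_cut_le.
Qed.

(** * Morrey norms *)

Variable lambda : R.
Hypothesis hlambdaN : lambda < N.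

Lemma morrey_norm_leP (f : X -> \bar R) (A : R) : 0 <= A ->
  (morrey_norm d mu p lambda f <= A%:E)%E <-> (forall x r, 0 < r ->
    (\int[mu]_(y in qball d x r) (`|f y| `^ p) <= (A `^ p * r `^ lambda)%:E)%E).
Proof.
move=> A0; have p0 : 0 < p by have := hp; lra.
have ballE x r : 0 < r ->
    ((((r `^ lambda)^-1)%:E * \int[mu]_(y in qball d x r) (`|f y| `^ p)) `^ p^-1
      <= A%:E)%E =
    (\int[mu]_(y in qball d x r) (`|f y| `^ p) <= (A `^ p * r `^ lambda)%:E)%E.
  move=> r0; have rl : 0 < r `^ lambda by rewrite powR_gt0.
  have : (0 <= \int[mu]_(y in qball d x r) (`|f y| `^ p))%E.
    by apply: integral_ge0 => y _; exact: poweR_ge0.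
  case: (\int[mu]_(y in _) _)%E => [I||]//; last first.
    move=> _; rewrite gt0_muley ?lte_fin ?invr_gt0//.
    by rewrite poweRyr ?gt_eqF ?invr_gt0.
  rewrite lee_fin => I0; rewrite -EFinM poweR_EFin !lee_fin.
  have Ir : 0 <= (r `^ lambda)^-1 * I by rewrite mulr_ge0// invr_ge0 ltW.
  rewrite -ler_pdivrMr// [I / _]mulrC; apply/idP/idP => h.
    rewrite -[leLHS](powRr1 Ir) -[X in _ `^ X](mulVf (lt0r_neq0 p0)) powRrM.
    by apply: ge0_ler_powR; rewrite ?nnegrE ?powR_ge0// ltW.
  rewrite -[leRHS](powRr1 A0) -[X in A `^ X](mulfV (lt0r_neq0 p0)) powRrM.
  by apply: ge0_ler_powR; rewrite ?nnegrE ?powR_ge0 ?invr_ge0// ltW.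
split=> [fA x r r0|fA].
  rewrite -ballE//; apply: le_trans fA; apply: ereal_sup_ubound.
  by exists x, r.
by apply: ge_ereal_sup => _ [x [r [r0 ->]]]; rewrite ballE//; exact: fA.
Qed.

(** The bound for averages over large balls, uniform in the centre; it is here that
[lambda < N] enters, through [t `^ (lambda - N) <= r `^ (lambda - N)]. *)
Lemma morrey_average_le (f : X -> \bar R) (A r : R) y t :
  measurable_fun setT f -> 0 < A -> 0 < r -> r <= t ->
  (morrey_norm d mu p lambda f <= A%:E)%E ->
  (\int[mu]_(z in qball d y t) `|f z| <=
   ((1 + C1^-1) * (A * r `^ ((lambda - N) / p)))%:E * mu (qball d y t))%E.
Proof.
move=> mf A0 r0 rt /(morrey_norm_leP _ (ltW A0)) fA.
have t0 : 0 < t by exact: lt_le_trans rt.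
have p0 : 0 < p by have := hp; lra.
set e := A * _.
have e0 : 0 < e by rewrite mulr_gt0// powR_gt0.
have ep0 : 0 < e `^ p by rewrite powR_gt0.
have mB := measurable_qball y t.
have mfp : measurable_fun setT (fun y => `|f y| `^ p)%E.
  by apply: (measurableT_comp (measurable_poweR p)); exact: measurableT_comp.
apply: (@le_trans _ _ (e%:E * mu (qball d y t) +
    (e / e `^ p)%:E * \int[mu]_(z in qball d y t) (`|f z| `^ p))%E).
  have c0 : (0 <= (e / e `^ p)%:E)%E by rewrite lee_fin divr_ge0 ?ltW.
  rewrite -integral_cst// -ge0_integralZl//; last 2 first.
  - exact: measurable_funTS.
  - by move=> z _; exact: poweR_ge0.
  rewrite -ge0_integralD//; last 3 first.
  - by move=> z _; rewrite lee_fin ltW.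
  - by move=> z _; rewrite mule_ge0// poweR_ge0.
  - by apply: measurable_funTS; exact: measurable_funeM.
  apply: ge0_le_integral => //.
  - by apply: measurable_funTS; exact: measurableT_comp.
  - apply: measurable_funTS; apply: emeasurable_funD => //.
    exact: measurable_funeM.
  - by move=> z _; exact: le_threshold_poweR.
have ef : (A `^ p * t `^ lambda <= e `^ p * t `^ N).
  rewrite /e powRM ?powR_ge0 ?(ltW A0)// -powRrM divfK ?gt_eqF// -mulrA.
  apply: ler_wpM2l; first exact: powR_ge0.
  rewrite -opprB powRN mulrC ler_pdivlMr ?powR_gt0//.
  have -> : t `^ N = t `^ lambda * t `^ (N - lambda).
    rewrite -powRD; last by rewrite (lt0r_neq0 t0) implybT.
    by rewrite addrC subrK.
  apply: ler_wpM2l; first exact: powR_ge0.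
  by apply: ge0_ler_powR; rewrite ?nnegrE ?subr_ge0//; exact: ltW.
rewrite mulrDl mul1r EFinD muleDl//; last exact: fin_num_qball.
apply: leeD2l.
have [mu1 _] := hmu y t0.
have c0 : (0 <= (e / e `^ p)%:E)%E by rewrite lee_fin divr_ge0 ?ltW.
apply: le_trans (lee_wpmul2l c0 (fA y t t0)) _.
have c1 : (0 <= (C1^-1 * e)%:E)%E by rewrite lee_fin mulr_ge0 ?invr_ge0 ?ltW.
apply: le_trans (lee_wpmul2l c1 mu1).
rewrite -!EFinM lee_fin.
rewrite [leRHS](_ : _ = e * t `^ N); last by field; rewrite gt_eqF.
by rewrite mulrAC -mulrA ler_pM2l// ler_pdivrMr// [leRHS]mulrC.
Qed.

(** The first summand comes from the level [s], the second from the strong type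
inequality on the dilated ball. *)
Definition morrey_const :=
  ((1 + C1^-1) `^ p * C2 + strong_const * (2 * k) `^ lambda) `^ p^-1.

Lemma morrey_norm_maximal_function_le (f : X -> \bar R) (A : R) :
  measurable_fun setT f -> 0 < A -> (morrey_norm d mu p lambda f <= A%:E)%E ->
  (morrey_norm d mu p lambda (maximal_function d mu f) <=
   (morrey_const * A)%:E)%E.
Proof.
move=> mf A0 fA; have p0 : 0 < p by have := hp; lra.
have D0 : 0 <= (1 + C1^-1) `^ p * C2 + strong_const * (2 * k) `^ lambda.
  by rewrite addr_ge0// mulr_ge0 ?powR_ge0 ?(ltW strong_const_gt0)// ltW.
apply/morrey_norm_leP; first by rewrite mulr_ge0 ?powR_ge0// ltW.
move=> x r r0; set e := A * r `^ ((lambda - N) / p).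
have e0 : 0 < e by rewrite mulr_gt0// powR_gt0.
have ci : 0 < 1 + C1^-1 by rewrite addr_gt0// invr_gt0.
have [k0 kr] : 0 < 2 * k /\ 0 < 2 * k * r.
  have k2 : 0 < 2 * k by have := hk; lra.
  by split=> //; rewrite mulr_gt0.
rewrite (@eq_integral _ _ _ mu _ (fun y => maximal_function d mu f y `^ p)%E);
  last by move=> y _; rewrite gee0_abs// maximal_function_ge0.
have := @local_strong_type f ((1 + C1^-1) * e) x r mf (mulr_gt0 ci e0) r0.
move/(_ (fun y t rt => morrey_average_le y mf A0 r0 rt fA)) => /le_trans; apply.
have := (morrey_norm_leP f (ltW A0)).1 fA x _ kr.
have sc : (0 <= strong_const%:E)%E by rewrite lee_fin ltW// strong_const_gt0.
move=> /(lee_wpmul2l sc); have [_ mu2] := hmu x r0.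
have s0 : (0 <= (((1 + C1^-1) * e) `^ p)%:E)%E by rewrite lee_fin powR_ge0.
move: (lee_wpmul2l s0 mu2) => /leeD /[apply] /le_trans; apply.
rewrite -!EFinM -EFinD lee_fin le_eqVlt; apply/orP; left; apply/eqP.
rewrite /morrey_const [in RHS](powRM _ (powR_ge0 _ _) (ltW A0)).
rewrite -powRrM mulVf ?gt_eqF// powRr1//.
rewrite (powRM _ (ltW ci) (ltW e0)) (powRM _ (ltW k0) (ltW r0)).
have -> : e `^ p = A `^ p * r `^ (lambda - N).
  by rewrite /e powRM ?powR_ge0 ?(ltW A0)// -powRrM divfK ?gt_eqF.
have -> : r `^ lambda = r `^ (lambda - N) * r `^ N.
  rewrite -powRD; last by rewrite (lt0r_neq0 r0) implybT.
  by rewrite subrK.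
by ring.
Qed.

End homogeneous.

Theorem theorem5p2 (R : realType) (disp : measure_display)
    (X : measurableType disp) (d : X -> X -> R)
    (mu : {measure set X -> \bar R})
    (hX : is_homogeneous_space d mu)
    (hinf : mu [set: X] = +oo%E)
    (N C1 C2 : R) (hN : 0 < N) (hC1 : 0 < C1) (hC2 : 0 < C2)
    (hmu : forall (x : X) (r : R), 0 < r ->
      ((C1 * r `^ N)%:E <= mu (qball d x r))%E /\
      (mu (qball d x r) <= (C2 * r `^ N)%:E)%E)
    (p lambda : R) (hp : 1 < p)
    (hlambda0 : 0 <= lambda) (hlambdaN : lambda < N) :
  bounded_in_morrey d mu p lambda (maximal_function d mu).
Proof.
have [k hk triangle] := qd_triangle (hs_quasidistance hX).
pose C := morrey_const N C1 C2 k p lambda.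
have C0 : 0 <= C by exact: powR_ge0.
exists C => // f [mf fy].
have [x0 _] : [set: X] !=set0.
  by apply/set0P/eqP => X0; move: hinf; rewrite X0 measure0.
have f0 : (0 <= morrey_norm d mu p lambda f)%E.
  apply: le_trans (poweR_ge0 _ _) (ereal_sup_ubound _).
  by exists x0, 1; split; [exact: ltr01|reflexivity].
have ffin : morrey_norm d mu p lambda f \is a fin_num by rewrite ge0_fin_numE.
have bound : (morrey_norm d mu p lambda (maximal_function d mu f) <=
    C%:E * morrey_norm d mu p lambda f)%E.
  rewrite -(fineK ffin); set a := fine _.
  have a0 : 0 <= a by exact: fine_ge0.
  have C10 : 0 < C + 1 by lra.
  (* The norm of f may vanish, whereas the estimate needs a positive bound A. *)
  apply/lee_addgt0Pr => e e0.
  have ae : 0 < a + e / (C + 1) by rewrite ltr_wpDl// divr_gt0.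
  apply: le_trans (_ : (_ <= (C * (a + e / (C + 1)))%:E)%E) _.
    apply: (morrey_norm_maximal_function_le hX) => //.
    by rewrite -(fineK ffin) lee_fin lerDl divr_ge0// ltW.
  rewrite -EFinM -EFinD lee_fin mulrDr lerD2l mulrA ler_pdivrMr// mulrDr mulr1.
  by rewrite mulrC lerDl ltW.
split=> //; split; first exact: (measurable_maximal_function hX).
by apply: le_lt_trans bound _; rewrite -(fineK ffin) -EFinM ltry.
Qed.
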